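(* Let $\mathbb{E}$ be a vector bundle over a Riemannian manifold $(M,g)$ equipped with a linear connection $\nabla$. For every $\psi\in\Gamma(\mathbb{E})$, all integers $0\le\ell\le k$ and all tangent vectors $X_1,\ldots,X_k$ at a point of $M$, $$\big(\mathrm{jet}^k_{X_1,\ldots,X_k}-\mathrm{jet}^\ell_{X_1,\ldots,X_\ell}\nabla^{k-\ell}_{X_{\ell+1},\ldots,X_k}\big)\psi=\sum_{\sigma\in\mathrm{S}_k\setminus\mathrm{S}_\ell}\frac{j_\sigma}{k_\sigma!}\,\nabla^{j_\sigma-1}_{X_{\sigma(1)},\ldots,X_{\sigma(j_\sigma-1)}}\,\mathrm{R}_{X_{k_\sigma},X_{\sigma(j_\sigma+1)}}\,\nabla^{k-j_\sigma-1}_{X_{\sigma(j_\sigma+2)},\ldots,X_{\sigma(k)}}\psi .$$ In particular, $$\mathrm{jet}^k_{X_1,\ldots,X_k}\psi-\nabla^k_{X_1,\ldots,X_k}\psi=\sum_{\substack{\sigma\in\mathrm{S}_k\\ \sigma\ne\mathrm{Id}}}\frac{j_\sigma}{k_\sigma!}\,\nabla^{j_\sigma-1}_{X_{\sigma(1)},\ldots,X_{\sigma(j_\sigma-1)}}\,\mathrm{R}_{X_{k_\sigma},X_{\sigma(j_\sigma+1)}}\,\nabla^{k-j_\sigma-1}_{X_{\sigma(j_\sigma+2)},\ldots,X_{\sigma(k)}}\psi .$$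
   Context: ''Riemannian manifold'' means a smooth manifold $M$ with a nondegenerate symmetric $(0,2)$-tensor field $g$ (any signature). $TM$ carries the Levi-Civita connection, with curvature $\mathrm{R}(X,Y)Z=\nabla_X\nabla_YZ-\nabla_Y\nabla_XZ-\nabla_{[X,Y]}Z$; tensor products of $T^*M$ with $\mathbb{E}$ carry the induced connections, all denoted $\nabla$. Iterated covariant derivatives: $\nabla^0\psi=\psi$ and $\nabla^{k+1}_{Y,X_1,\ldots,X_k}\psi=\nabla_Y\nabla^k_{X_1,\ldots,X_k}\psi-\sum_i\nabla^k_{X_1,\ldots,\nabla_YX_i,\ldots,X_k}\psi$. Symmetrized iterated covariant derivative: $\mathrm{jet}^k_{X_1,\ldots,X_k}\psi=\frac1{k!}\sum_{\sigma\in\mathrm{S}_k}\nabla^k_{X_{\sigma(1)},\ldots,X_{\sigma(k)}}\psi$. The expression $\mathrm{jet}^\ell_{X_1,\ldots,X_\ell}\nabla^{k-\ell}_{X_{\ell+1},\ldots,X_k}\psi$ means $\mathrm{jet}^\ell_{X_1,\ldots,X_\ell}$ of the section $\nabla^{k-\ell}\psi$ of $\bigotimes^{k-\ell}T^*M\otimes\mathbb{E}$, evaluated on $X_{\ell+1},\ldots,X_k$, i.e. $\frac1{\ell!}\sum_{\sigma\in \mathrm{S}_\ell}\nabla^k_{X_{\sigma(1)},\ldots,X_{\sigma(\ell)},X_{\ell+1},\ldots,X_k}\psi$. Curvature operators (the Leibniz rule is not applied): $\mathrm{R}_{A,B}\nabla^m_{Y_1,\ldots,Y_m}\psi$ denotes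 the curvature of the induced connection on $\bigotimes^mT^*M\otimes\mathbb{E}$ applied to $\nabla^m\psi$ and evaluated on $Y_1,\ldots,Y_m$, i.e. $\mathrm{R}^{\mathbb{E}}_{A,B}(\nabla^m_{Y_1,\ldots,Y_m}\psi)-\sum_\nu\nabla^m_{Y_1,\ldots,\mathrm{R}(A,B)Y_\nu,\ldots,Y_m}\psi$, where $\mathrm{R}^{\mathbb{E}}$ is the curvature of $\mathbb{E}$. Then $\nabla^r_{Z_1,\ldots,Z_r}\mathrm{R}_{A,B}\nabla^m_{Y_1,\ldots,Y_m}\psi$ denotes $\nabla^r_{Z_1,\ldots,Z_r}$ applied to the section $(A,B,Y_1,\ldots,Y_m)\mapsto\mathrm{R}_{A,B}\nabla^m_{Y_1,\ldots,Y_m}\psi$ of $\bigotimes^{m+2}T^*M\otimes\mathbb{E}$, evaluated on $A,B,Y_1,\ldots,Y_m$. For $\ell\le k$, $\mathrm{S}_\ell\subset\mathrm{S}_k$ is the canonical inclusion as the permutations fixing $\ell+1,\ldots,k$ ($\mathrm{S}_0$ being the trivial group), and $\setminus$ is the set difference. For $\sigma\in\mathrm{S}_k$, $\sigma\ne\mathrm{Id}$, $k_\sigma$ is the largest index with $\sigma(k_\sigma)\ne k_\sigma$, and $j_\sigma=\sigma^{-1}(k_\sigma)$. *)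

(* Defs.v *)
From HB Require Import structures.
From mathcomp Require Import all_boot all_order all_algebra perm.
From mathcomp Require Import ring.
From mathcomp Require Import mathcomp_extra boolp classical_sets functions.
From mathcomp Require Import reals topology normedtype derive.

Set Implicit Arguments.
Unset Strict Implicit.
Unset Printing Implicit Defensive.

Import Order.TTheory GRing.Theory Num.Theory.
Import numFieldNormedType.Exports.

Local Open Scope classical_set_scope.
Local Open Scope ring_scope.

Section SmoothOnOpenSubsets.
Context {R : realType} {n : nat}.
Implicit Types (U : set 'rV[R]_n) (f g : 'rV[R]_n -> R).

(* Continuity at every order makes this the usual C^m: existence and continuity
   of all iterated directional (equivalently, partial) derivatives. *)
Fixpoint Ck (m : nat) U f : Prop :=
  (forall x, U x -> {for x, continuous f}) /\
  (if m is m'.+1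
   then forall v, (forall x, U x -> derivable f x v) /\ Ck m' U ('D_v f)
   else True).

Definition Cinfty U f := forall m, Ck m U f.

Lemma Ck_continuous m U f : Ck m U f -> forall x, U x -> {for x, continuous f}.
Proof. by case: m => [|m] []. Qed.

Lemma CkS m U f : Ck m.+1 U f -> Ck m U f.
Proof.
elim: m f => [|m IH] f [cf Df]; split=> // v.
by have [dfv Dfv] := Df v; split=> //; apply: IH.
Qed.

Lemma eq_Ck m U f g : open U -> (forall x, U x -> f x = g x) ->
  Ck m U f -> Ck m U g.
Proof.
move=> oU.
have loc (h1 h2 : _ -> R) x : (forall x, U x -> h1 x = h2 x) -> U x -> \near x, h1 x = h2 x.
  move=> h12 Ux; apply: (@filterS _ _ _ U) => //.
  by apply: open_nbhs_nbhs; split.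
have cnt (h1 h2 : _ -> R) : (forall x, U x -> h1 x = h2 x) ->
    (forall x, U x -> {for x, continuous h1}) ->
    forall x, U x -> {for x, continuous h2}.
  move=> h12 c1 x Ux; rewrite /prop_for /continuous_at -h12//.
  have nh := loc _ _ _ h12 Ux.
  have F := nbhs_filter x.
  exact: (cvg_trans (near_eq_cvg nh) (c1 x Ux)).
elim: m f g => [|m IH] f g fg [cf Df]; split=> //; try exact: cnt fg cf.
move=> v; have [dfv Dfv] := Df v; split=> [x Ux|].
  have nfg : {near x, f =1 g} := loc f g x fg Ux.
  exact: near_eq_derivable nfg (dfv x Ux).
by apply: IH Dfv => x Ux; apply: near_eq_derive; exact: loc.
Qed.

Lemma Ck_cst m U (c : R) : Ck m U (cst c).
Proof.
elim: m c => [|m IH] c; split=> //; try by move=> x _; apply: cst_continuous.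
move=> v; split=> [x _|]; first exact: derivable_cst.
suff -> : 'D_v (cst c : 'rV[R]_n -> R) = cst 0 by exact: IH.
by apply/funext => x; rewrite derive_cst.
Qed.

Lemma CkD m U f g : open U -> Ck m U f -> Ck m U g -> Ck m U (f + g).
Proof.
move=> oU; elim: m f g => [|m IH] f g [cf Df] [cg Dg]; split=> //;
  try by move=> x Ux; apply: continuousD; [exact: cf|exact: cg].
move=> v; have [dfv Dfv] := Df v; have [dgv Dgv] := Dg v.
split=> [x Ux|]; first by apply: derivableD; [exact: dfv|exact: dgv].
apply: eq_Ck (IH _ _ Dfv Dgv) => // x Ux.
by rewrite deriveD//; [exact: dfv|exact: dgv].
Qed.

Lemma CkM m U f g : open U -> Ck m U f -> Ck m U g -> Ck m U (f * g).
Proof.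
move=> oU; elim: m f g => [|m IH] f g Cf Cg; split=> //;
  try by move=> x Ux; apply: continuousM;
    [exact: (Ck_continuous Cf)|exact: (Ck_continuous Cg)].
move=> v; have [dfv Dfv] := Cf.2 v; have [dgv Dgv] := Cg.2 v.
split=> [x Ux|]; first by apply: derivableM; [exact: dfv|exact: dgv].
have C1 := IH _ _ (CkS Cf) Dgv; have C2 := IH _ _ (CkS Cg) Dfv.
apply: eq_Ck (CkD oU C1 C2) => // x Ux.
by rewrite deriveM//; [exact: dfv|exact: dgv].
Qed.

End SmoothOnOpenSubsets.

Section Manifolds.
Context (R : realType) (n : nat).

Record chart (T : topologicalType) := Chart {
  chart_dom : set T;
  chart_cod : set 'rV[R]_n;
  chart_map : T -> 'rV[R]_n;
  chart_inv : 'rV[R]_n -> T;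
  chart_dom_open : open chart_dom;
  chart_cod_open : open chart_cod;
  chart_mapP : forall p, chart_dom p -> chart_cod (chart_map p);
  chart_invP : forall x, chart_cod x -> chart_dom (chart_inv x);
  chart_mapK : forall p, chart_dom p -> chart_inv (chart_map p) = p;
  chart_invK : forall x, chart_cod x -> chart_map (chart_inv x) = x;
  chart_map_continuous : forall p, chart_dom p -> {for p, continuous chart_map};
  chart_inv_continuous : forall x, chart_cod x -> {for x, continuous chart_inv}
}.

Record manifold := Manifold {
  carrier :> topologicalType;
  manifold_hausdorff : hausdorff_space carrier;
  manifold_second_countable : @second_countable carrier;
  atlas : set (chart carrier);
  atlas_cover : forall p, exists2 c, atlas c & chart_dom c p;
  atlas_compat : forall c d, atlas c -> atlas d -> forall i : 'I_n,
    Cinfty (chart_cod c `&` (chart_inv c @^-1` chart_dom d))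
           (fun x => chart_map d (chart_inv c x) 0 i)
}.

Context (M : manifold).

Definition smooth_on (U : set M) (f : M -> R) : Prop :=
  forall c, atlas c ->
    Cinfty (chart_cod c `&` (chart_inv c @^-1` U)) (f \o chart_inv c).

Lemma chart_preimage_open (c : chart M) (U : set M) : open U ->
  open (chart_cod c `&` (chart_inv c @^-1` U)).
Proof.
move=> oU; rewrite openE => x [cx Ux]; apply: filterI.
  by apply: open_nbhs_nbhs; split=> //; exact: chart_cod_open.
by apply: (chart_inv_continuous cx); apply: open_nbhs_nbhs; split.
Qed.

Lemma eq_smooth_on (U : set M) (f g : M -> R) : open U ->
  (forall p, U p -> f p = g p) -> smooth_on U f -> smooth_on U g.
Proof.
move=> oU fg sf c ac m; apply: eq_Ck (sf c ac m).
  exact: chart_preimage_open.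
by move=> x [_ Ux] /=; exact: fg.
Qed.

Lemma smooth_on_cst (U : set M) (a : R) : smooth_on U (cst a).
Proof. by move=> c _ m; exact: Ck_cst. Qed.

Lemma smooth_onD (U : set M) (f g : M -> R) : open U ->
  smooth_on U f -> smooth_on U g -> smooth_on U (f + g).
Proof.
move=> oU sf sg c ac m.
have oV := @chart_preimage_open c _ oU.
exact: eq_Ck (CkD oV (sf c ac m) (sg c ac m)).
Qed.

Lemma smooth_onM (U : set M) (f g : M -> R) : open U ->
  smooth_on U f -> smooth_on U g -> smooth_on U (f * g).
Proof.
move=> oU sf sg c ac m.
have oV := @chart_preimage_open c _ oU.
exact: eq_Ck (CkM oV (sf c ac m) (sg c ac m)).
Qed.

Lemma smooth_on_sub (U V : set M) (f : M -> R) : V `<=` U ->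
  smooth_on U f -> smooth_on V f.
Proof.
move=> VU sf c ac m; have sub : chart_cod c `&` (chart_inv c @^-1` V) `<=`
  chart_cod c `&` (chart_inv c @^-1` U) by move=> x [cx /VU].
have mono A B m' g : B `<=` A -> Ck m' A g -> @Ck R n m' B g.
  move=> BA; elim: m' g => [|m' IH] g [cg Dg]; split=> //;
    try by move=> x /BA; exact: cg.
  move=> v; have [dv Dv] := Dg v; split=> [x /BA|]; first exact: dv.
  exact: IH.
exact: mono sub (sf c ac m).
Qed.

Record smooth_fun := SmoothFun {
  smooth_val :> M -> R;
  smooth_valP : smooth_on setT smooth_val
}.

Lemma smooth_fun_inj (f g : smooth_fun) : (forall p, f p = g p) -> f = g.
Proof.
case: f g => f sf [g sg] /= fg; have efg : f = g by apply/funext.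
by subst g; congr SmoothFun; apply: Prop_irrelevance.
Qed.

HB.instance Definition _ := gen_eqMixin smooth_fun.
HB.instance Definition _ := gen_choiceMixin smooth_fun.

Definition sf_cst (a : R) := SmoothFun (smooth_on_cst setT a).
Definition sf_add (f g : smooth_fun) :=
  SmoothFun (smooth_onD openT (smooth_valP f) (smooth_valP g)).
Definition sf_mul (f g : smooth_fun) :=
  SmoothFun (smooth_onM openT (smooth_valP f) (smooth_valP g)).
Definition sf_opp (f : smooth_fun) := sf_mul (sf_cst (- 1)) f.

Fact sf_addA : associative sf_add.
Proof. by move=> f g h; apply: smooth_fun_inj => p; apply: addrA. Qed.
Fact sf_addC : commutative sf_add.
Proof. by move=> f g; apply: smooth_fun_inj => p; apply: addrC. Qed.
Fact sf_add0 : left_id (sf_cst 0) sf_add.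
Proof. by move=> f; apply: smooth_fun_inj => p; apply: add0r. Qed.
Fact sf_addN : left_inverse (sf_cst 0) sf_opp sf_add.
Proof.
move=> f; apply: smooth_fun_inj => p /=.
by rewrite !fctE mulN1r addNr.
Qed.
HB.instance Definition _ :=
  GRing.isZmodule.Build smooth_fun sf_addA sf_addC sf_add0 sf_addN.

Fact sf_mulA : associative sf_mul.
Proof. by move=> f g h; apply: smooth_fun_inj => p; apply: mulrA. Qed.
Fact sf_mulC : commutative sf_mul.
Proof. by move=> f g; apply: smooth_fun_inj => p; apply: mulrC. Qed.
Fact sf_mul1 : left_id (sf_cst 1) sf_mul.
Proof. by move=> f; apply: smooth_fun_inj => p; apply: mul1r. Qed.
Fact sf_mulDl : left_distributive sf_mul +%R.
Proof. by move=> f g h; apply: smooth_fun_inj => p; apply: mulrDl. Qed.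
HB.instance Definition _ := GRing.Zmodule_isComPzRing.Build smooth_fun
  sf_mulA sf_mulC sf_mul1 sf_mulDl.

Lemma sf_addE (f g : smooth_fun) p : (f + g) p = f p + g p. Proof. by []. Qed.
Lemma sf_mulE (f g : smooth_fun) p : (f * g) p = f p * g p. Proof. by []. Qed.
Lemma sf_oppE (f : smooth_fun) p : (- f) p = - f p.
Proof. exact: mulN1r. Qed.

(* Tangent vectors are derivations of C^oo(M) at a point and vector fields are
   derivations of C^oo(M). *)
Definition derivation_at (p : M) (v : smooth_fun -> R) : Prop :=
  [/\ forall f h, v (f + h) = v f + v h,
      forall a f, v (sf_cst a * f) = a * v f
    & forall f h, v (f * h) = v f * h p + f p * v h].

Record tangent (p : M) := Tangent {
  tangent_val :> smooth_fun -> R;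
  tangentP : derivation_at p tangent_val
}.

Definition derivation (X : smooth_fun -> smooth_fun) : Prop :=
  [/\ forall f h, X (f + h) = X f + X h,
      forall a f, X (sf_cst a * f) = sf_cst a * X f
    & forall f h, X (f * h) = X f * h + f * X h].

Record vfield := VField {
  vfield_val :> smooth_fun -> smooth_fun;
  vfieldP : derivation vfield_val
}.

Fact vfield_at_subproof (p : M) (X : vfield) : derivation_at p (fun f => X f p).
Proof.
by case: (vfieldP X) => XD XZ XM; split=> *; rewrite ?XD ?XZ ?XM.
Qed.
Definition vfield_at (p : M) (X : vfield) : tangent p :=
  Tangent (vfield_at_subproof p X).

Lemma tangent_inj p (v w : tangent p) : (forall f, v f = w f) -> v = w.
Proof.
case: v w => v ? [w ?] /= vw; have evw : v = w by apply/funext.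
by subst w; congr Tangent; apply: Prop_irrelevance.
Qed.

HB.instance Definition _ p := gen_eqMixin (tangent p).
HB.instance Definition _ p := gen_choiceMixin (tangent p).

Fact tangent0_subproof (p : M) : derivation_at p (fun=> 0).
Proof. by split=> *; rewrite ?(mulr0, mul0r, addr0). Qed.
Definition tangent0 (p : M) := Tangent (tangent0_subproof p).

Fact tangent_add_subproof (p : M) (v w : tangent p) :
  derivation_at p (fun f => v f + w f).
Proof.
case: (tangentP v) (tangentP w) => [vD vZ vM] [wD wZ wM].
by split=> *; rewrite ?(vD, vZ, vM) ?(wD, wZ, wM); ring.
Qed.
Definition tangent_add (p : M) (v w : tangent p) :=
  Tangent (tangent_add_subproof v w).

Fact tangent_scale_subproof (p : M) (a : R) (v : tangent p) :
  derivation_at p (fun f => a * v f).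
Proof.
by case: (tangentP v) => [vD vZ vM]; split=> *; rewrite ?(vD, vZ, vM); ring.
Qed.
Definition tangent_scale (p : M) (a : R) (v : tangent p) :=
  Tangent (tangent_scale_subproof a v).

Definition tangent_opp (p : M) (v : tangent p) := tangent_scale (- 1) v.

Fact tangent_addA p : associative (@tangent_add p).
Proof. by move=> u v w; apply: tangent_inj => f /=; rewrite addrA. Qed.
Fact tangent_addC p : commutative (@tangent_add p).
Proof. by move=> u v; apply: tangent_inj => f /=; rewrite addrC. Qed.
Fact tangent_add0 p : left_id (tangent0 p) (@tangent_add p).
Proof. by move=> u; apply: tangent_inj => f /=; rewrite add0r. Qed.
Fact tangent_addN p :
  left_inverse (tangent0 p) (@tangent_opp p) (@tangent_add p).
Proof. by move=> u; apply: tangent_inj => f /=; rewrite mulN1r addNr. Qed.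
HB.instance Definition _ p := GRing.isZmodule.Build (tangent p)
  (@tangent_addA p) (@tangent_addC p) (@tangent_add0 p) (@tangent_addN p).

Fact tangent_scaleA p a b (v : tangent p) :
  tangent_scale a (tangent_scale b v) = tangent_scale (a * b) v.
Proof. by apply: tangent_inj => f /=; rewrite mulrA. Qed.
Fact tangent_scale1 p : left_id 1 (@tangent_scale p).
Proof. by move=> v; apply: tangent_inj => f /=; rewrite mul1r. Qed.
Fact tangent_scaleDr p : right_distributive (@tangent_scale p) +%R.
Proof. by move=> a v w; apply: tangent_inj => f /=; rewrite mulrDr. Qed.
Fact tangent_scaleDl p (v : tangent p) :
  {morph (@tangent_scale p)^~ v : a b / a + b}.
Proof. by move=> a b; apply: tangent_inj => f /=; rewrite mulrDl. Qed.
HB.instance Definition _ p := GRing.Zmodule_isLmodule.Build R (tangent p)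
  (@tangent_scaleA p) (@tangent_scale1 p) (@tangent_scaleDr p)
  (@tangent_scaleDl p).

Lemma vfield_inj (X Y : vfield) : (forall f, X f = Y f) -> X = Y.
Proof.
case: X Y => X ? [Y ?] /= XY; have eXY : X = Y by apply/funext.
by subst Y; congr VField; apply: Prop_irrelevance.
Qed.

HB.instance Definition _ := gen_eqMixin vfield.
HB.instance Definition _ := gen_choiceMixin vfield.

Fact vfield0_subproof : derivation (fun=> 0).
Proof. by split=> *; rewrite ?(mulr0, mul0r, addr0). Qed.
Definition vfield0 := VField vfield0_subproof.

Fact vfield_add_subproof (X Y : vfield) : derivation (fun f => X f + Y f).
Proof.
case: (vfieldP X) (vfieldP Y) => [XD XZ XM] [YD YZ YM].
by split=> *; rewrite ?(XD, XZ, XM) ?(YD, YZ, YM); ring.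
Qed.
Definition vfield_add (X Y : vfield) := VField (vfield_add_subproof X Y).

Fact vfield_scale_subproof (h : smooth_fun) (X : vfield) :
  derivation (fun f => h * X f).
Proof.
by case: (vfieldP X) => [XD XZ XM]; split=> *; rewrite ?(XD, XZ, XM); ring.
Qed.
Definition vfield_scale (h : smooth_fun) (X : vfield) :=
  VField (vfield_scale_subproof h X).

Definition vfield_opp (X : vfield) := vfield_scale (- 1) X.

Fact vfield_addA : associative vfield_add.
Proof. by move=> X Y Z; apply: vfield_inj => f /=; rewrite addrA. Qed.
Fact vfield_addC : commutative vfield_add.
Proof. by move=> X Y; apply: vfield_inj => f /=; rewrite addrC. Qed.
Fact vfield_add0 : left_id vfield0 vfield_add.
Proof. by move=> X; apply: vfield_inj => f /=; rewrite add0r. Qed.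
Fact vfield_addN : left_inverse vfield0 vfield_opp vfield_add.
Proof. by move=> X; apply: vfield_inj => f /=; rewrite mulN1r addNr. Qed.
HB.instance Definition _ := GRing.isZmodule.Build vfield
  vfield_addA vfield_addC vfield_add0 vfield_addN.

Fact vfield_scaleA f h (X : vfield) :
  vfield_scale f (vfield_scale h X) = vfield_scale (f * h) X.
Proof. by apply: vfield_inj => a /=; rewrite mulrA. Qed.
Fact vfield_scale1 : left_id 1 vfield_scale.
Proof. by move=> X; apply: vfield_inj => f /=; rewrite mul1r. Qed.
Fact vfield_scaleDr : right_distributive vfield_scale +%R.
Proof. by move=> h X Y; apply: vfield_inj => f /=; rewrite mulrDr. Qed.
Fact vfield_scaleDl (X : vfield) :
  {morph vfield_scale^~ X : f h / f + h}.
Proof. by move=> f h; apply: vfield_inj => a /=; rewrite mulrDl. Qed.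
HB.instance Definition _ := GRing.Zmodule_isLmodule.Build smooth_fun vfield
  vfield_scaleA vfield_scale1 vfield_scaleDr vfield_scaleDl.

Fact lie_bracket_subproof (X Y : vfield) :
  derivation (fun f => X (Y f) - Y (X f)).
Proof.
case: (vfieldP X) (vfieldP Y) => [XD XZ XM] [YD YZ YM].
split=> *; rewrite ?(XD, XZ, XM) ?(YD, YZ, YM);
  by rewrite ?(XD, XZ, XM) ?(YD, YZ, YM); ring.
Qed.
Definition lie_bracket (X Y : vfield) := VField (lie_bracket_subproof X Y).

End Manifolds.

Section PseudoRiemannianMetrics.
Context (R : realType) (n : nat) (M : manifold R n).

(* No positivity: the signature is arbitrary. *)
Record metric := Metric {
  metric_val :> forall p : M, tangent p -> tangent p -> R;
  metricC : forall p (v w : tangent p), metric_val v w = metric_val w v;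
  metricP : forall p (a : R) (u v w : tangent p),
    metric_val (a *: u + v) w = a * metric_val u w + metric_val v w;
  metric_nondegenerate : forall p (v : tangent p),
    (forall w, metric_val v w = 0) -> v = 0;
  metric_smooth : forall X Y : vfield M,
    smooth_on setT (fun p => metric_val (vfield_at p X) (vfield_at p Y))
}.

Definition metric_fun (g : metric) (X Y : vfield M) : smooth_fun M :=
  SmoothFun (metric_smooth g X Y).

End PseudoRiemannianMetrics.

Section VectorBundles.
Context (R : realType) (n : nat) (M : manifold R n) (r : nat).

Record local_triv (F : M -> lmodType R) := LocalTriv {
  triv_dom : set M;
  triv_map : forall p, F p -> 'rV[R]_r;
  triv_inv : forall p, 'rV[R]_r -> F p;
  triv_dom_open : open triv_dom;
  triv_linear : forall p, triv_dom p -> forall (a : R) (u v : F p),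
    triv_map (a *: u + v) = a *: triv_map u + triv_map v;
  triv_mapK : forall p, triv_dom p -> cancel (@triv_map p) (@triv_inv p);
  triv_invK : forall p, triv_dom p -> cancel (@triv_inv p) (@triv_map p)
}.

(* The total space and its manifold structure are determined by the fibers and
   the smoothly compatible family of local trivializations. *)
Record vbundle := VBundle {
  fiber :> M -> lmodType R;
  trivs : set (local_triv fiber);
  trivs_cover : forall p, exists2 t, trivs t & triv_dom t p;
  trivs_compat : forall t u, trivs t -> trivs u ->
    forall (w : 'rV[R]_r) (i : 'I_r),
    smooth_on (triv_dom t `&` triv_dom u)
              (fun p => triv_map u (triv_inv t p w) 0 i)
}.

Context (E : vbundle).

Definition smooth_section (s : forall p, E p) : Prop :=
  forall t, trivs t -> forall i : 'I_r,
    smooth_on (triv_dom t) (fun p => triv_map t (s p) 0 i).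

Record section := SmoothSection {
  section_val :> forall p, E p;
  section_smooth : smooth_section section_val
}.

Lemma section_inj (s t : section) : (forall p, s p = t p) -> s = t.
Proof.
case: s t => s ? [t ?] /= st.
have est : s = t by apply: functional_extensionality_dep.
by subst t; congr SmoothSection; apply: Prop_irrelevance.
Qed.

HB.instance Definition _ := gen_eqMixin section.
HB.instance Definition _ := gen_choiceMixin section.

Fact section_scaleadd_subproof (f : smooth_fun M) (s t : section) :
  smooth_section (fun p => f p *: s p + t p).
Proof.
move=> u Tu i; have oU := triv_dom_open u.
have sf := smooth_on_sub (@subsetT _ (triv_dom u)) (smooth_valP f).
have sfs := smooth_onM oU sf (section_smooth s Tu i).
apply: eq_smooth_on (smooth_onD oU sfs (section_smooth t Tu i)) => // p Up.
by rewrite triv_linear// !mxE.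
Qed.

Fact section0_subproof : smooth_section (fun p => 0).
Proof.
move=> u Tu i; have oU := triv_dom_open u.
apply: eq_smooth_on (smooth_on_cst _ 0) => // p Up.
have := triv_linear Up (- 1) 0 0.
by rewrite scaler0 add0r scaleN1r addNr => ->; rewrite mxE.
Qed.
Definition section0 := SmoothSection section0_subproof.

Definition section_scaleadd f s t := SmoothSection (section_scaleadd_subproof f s t).
Definition section_add (s t : section) := section_scaleadd 1 s t.
Definition section_scale (f : smooth_fun M) (s : section) :=
  section_scaleadd f s section0.
Definition section_opp (s : section) := section_scale (sf_cst M (- 1)) s.

Fact section_addA : associative section_add.
Proof. by move=> s t u; apply: section_inj => p /=; rewrite !scale1r addrA. Qed.
Fact section_addC : commutative section_add.
Proof. by move=> s t; apply: section_inj => p /=; rewrite !scale1r addrC. Qed.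
Fact section_add0 : left_id section0 section_add.
Proof. by move=> s; apply: section_inj => p /=; rewrite !scale1r add0r. Qed.
Fact section_addN : left_inverse section0 section_opp section_add.
Proof.
move=> s; apply: section_inj => p /=.
by rewrite scale1r addr0 scaleN1r addNr.
Qed.
HB.instance Definition _ := GRing.isZmodule.Build section
  section_addA section_addC section_add0 section_addN.

Lemma section_addE (s t : section) p : (s + t) p = s p + t p.
Proof. by rewrite -[in RHS](scale1r (s p)). Qed.

Fact section_scaleA f h (s : section) :
  section_scale f (section_scale h s) = section_scale (f * h) s.
Proof. by apply: section_inj => p /=; rewrite !addr0 scalerA. Qed.
Fact section_scale1 : left_id 1 section_scale.
Proof. by move=> s; apply: section_inj => p /=; rewrite addr0 scale1r. Qed.
Fact section_scaleDr : right_distributive section_scale +%R.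
Proof.
move=> f s t; apply: section_inj => p; rewrite section_addE /=.
by rewrite !addr0 scale1r scalerDr.
Qed.
Fact section_scaleDl (s : section) : {morph section_scale^~ s : f h / f + h}.
Proof.
move=> f h; apply: section_inj => p; rewrite section_addE /=.
by rewrite !addr0 -scalerDl.
Qed.
HB.instance Definition _ := GRing.Zmodule_isLmodule.Build (smooth_fun M) section
  section_scaleA section_scale1 section_scaleDr section_scaleDl.

End VectorBundles.

Section Connections.
Context (R : realType) (n : nat) (M : manifold R n).

(* For V = section E this is a linear connection on E, for V = vfield M a
   linear connection on TM. *)
Record connection (V : lmodType (smooth_fun M)) := Connection {
  nabla :> vfield M -> V -> V;
  nablaDl : forall X Y s, nabla (X + Y) s = nabla X s + nabla Y s;
  nablaZl : forall f X s, nabla (f *: X) s = f *: nabla X s;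
  nablaDr : forall X s t, nabla X (s + t) = nabla X s + nabla X t;
  nablaZr : forall X (f : smooth_fun M) s,
    nabla X (f *: s) = X f *: s + f *: nabla X s
}.

Definition curvature V (N : connection V) (X Y : vfield M) (s : V) : V :=
  N X (N Y s) - N Y (N X s) - N (lie_bracket X Y) s.

Definition is_levi_civita (g : metric M) (D : connection (vfield M)) : Prop :=
  (forall X Y, D X Y - D Y X = lie_bracket X Y) /\
  (forall X Y Z : vfield M, X (metric_fun g Y Z) =
                 metric_fun g (D X Y) Z + metric_fun g Y (D X Z)).

Context (D : connection (vfield M)) (V : lmodType (smooth_fun M))
        (N : connection V).

(* A section of the m-fold tensor power of T*M with values in E is represented
   by its values on lists of m vector fields; only lists of that length are
   meaningful. Its value at tangent vectors x_1, ..., x_m in T_pM is the value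
   at p on any vector fields extending them. *)
Definition tensor := seq (vfield M) -> V.

Definition tensor_of_section (psi : V) : tensor :=
  fun xs => if xs is [::] then psi else 0.

Definition covd (T : tensor) : tensor := fun xs =>
  if xs is Y :: ys then
    N Y (T ys) - \sum_(i < size ys) T (set_nth 0 ys i (D Y ys`_i))
  else 0.

(* The induced curvature R_{A,B} T, as a tensor in (A, B, Y_1, ..., Y_m). *)
Definition curv (T : tensor) : tensor := fun xs =>
  if xs is [:: A, B & ys] then
    curvature N A B (T ys)
    - \sum_(i < size ys) T (set_nth 0 ys i (curvature D A B ys`_i))
  else 0.

Definition iter_covd (k : nat) (T : tensor) : tensor := iter k covd T.

Definition nablak (k : nat) (psi : V) : tensor :=
  iter_covd k (tensor_of_section psi).

(* jet^l_{Z_1, ..., Z_l} T evaluated on the remaining arguments ys. *)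
Definition jet (l : nat) (T : tensor) (Z : 'I_l -> vfield M)
    (ys : seq (vfield M)) : V :=
  sf_cst M (l`!%:R^-1) *:
    (\sum_(s : 'S_l) iter_covd l T ([seq Z (s i) | i <- enum 'I_l] ++ ys)).

(* k_s for s <> 1, with indices in 'I_k counted from 0. *)
Definition top_moved k (s : 'S_k) : option 'I_k :=
  [pick i : 'I_k | (s i != i) && [forall j : 'I_k, (i < j)%N ==> (s j == j)]].

(* S_l inside S_k. *)
Definition Sym_first (k l : nat) : {set 'S_k} :=
  [set s : 'S_k | [forall i : 'I_k, (l <= i)%N ==> (s i == i)]]%SET.

(* The summand indexed by s: the 0-based indices kap and j stand for
   k_s = kap.+1 and j_s = j.+1. *)
Definition curv_term k (X : 'I_k -> vfield M) (psi : V) (s : 'S_k) : V :=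
  if top_moved s is Some kap then
    let j := (s^-1)%g kap in
    let Xs := [seq X (s i) | i <- enum 'I_k] in
    sf_cst M (j.+1%:R / kap.+1`!%:R) *:
      (iter_covd j (curv (nablak (k - j.+2) psi))
         (take j Xs ++ [:: X kap, Xs`_j.+1 & drop j.+2 Xs]))
  else 0.

End Connections.

(* Main.v *)
(* Write F(s) for nabla^k psi evaluated on X_{s(1)}, ..., X_{s(k)}. For a
   torsion-free connection on TM the Ricci identity says that curv T is nabla^2 T
   minus nabla^2 T with its first two arguments swapped, and covariant
   derivatives commute with permutations of the arguments; hence the summand of s
   is j_s / k_s! times F(s) - F(s o (j_s j_s+1)). Fix k_s = m and let A_j be the
   sum of F(s) over the s in S_m with s(j) = m. The summands with k_s = m add up
   to 1/m! sum_{j < m} j (A_j - A_{j+1}) = 1/m! (sum_{j <= m} A_j - m A_m), and A_m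
   is the sum of F over S_{m-1}: this is the average of F over S_m minus its
   average over S_{m-1}, and summing over l < m <= k telescopes. *)

Require Import Defs.
From mathcomp Require Import all_boot all_order all_algebra fingroup perm.
From mathcomp Require Import reals topology.
From mathcomp Require boolp.
Import GRing.Theory.
Local Open Scope ring_scope.

Set Implicit Arguments.
Unset Strict Implicit.
Unset Printing Implicit Defensive.

(** * The Ricci identity *)

Section SlotSums.
Context {A B : zmodType}.
Implicit Types (T : seq A -> B) (a b : A -> A).

(* The action of a on the tensor T as a derivation, up to sign. *)
Definition slot_sum a T : seq A -> B :=
  fun ys => \sum_(i < size ys) T (set_nth 0 ys i (a ys`_i)).

Definition slot_additive T := forall xs y z ys,
  T (xs ++ (y + z) :: ys) = T (xs ++ y :: ys) + T (xs ++ z :: ys).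

Lemma slot_sum_nil a T : slot_sum a T [::] = 0.
Proof. exact: big_ord0. Qed.

Lemma slot_sum_cons a T y ys : slot_sum a T (y :: ys) =
  T (a y :: ys) + slot_sum a (fun zs => T (y :: zs)) ys.
Proof. exact: big_ord_recl. Qed.

Lemma slot_sumD a T1 T2 ys : slot_sum a (fun zs => T1 zs + T2 zs) ys =
  slot_sum a T1 ys + slot_sum a T2 ys.
Proof. exact: big_split. Qed.

Lemma slot_sumB a T1 T2 ys : slot_sum a (fun zs => T1 zs - T2 zs) ys =
  slot_sum a T1 ys - slot_sum a T2 ys.
Proof. exact: sumrB. Qed.

Lemma slot_additive_cons T y : slot_additive T ->
  slot_additive (fun zs => T (y :: zs)).
Proof. by move=> Tadd xs u v ys; apply: (Tadd (y :: xs)). Qed.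

Lemma slot_sum_funD a b T ys : slot_additive T ->
  slot_sum (fun y => a y + b y) T ys = slot_sum a T ys + slot_sum b T ys.
Proof.
elim: ys T => [|y ys IH] T Tadd; first by rewrite !slot_sum_nil addr0.
rewrite !slot_sum_cons IH; last exact: slot_additive_cons.
by rewrite (Tadd [::]) addrACA.
Qed.

Lemma slot_sum_funB a b T ys : slot_additive T ->
  slot_sum (fun y => a y - b y) T ys = slot_sum a T ys - slot_sum b T ys.
Proof.
move=> Tadd; apply/eqP; rewrite eq_sym subr_eq -slot_sum_funD //; apply/eqP.
by apply: eq_bigr => i _; rewrite subrK.
Qed.

Lemma slot_sum_additive a T : {morph a : y z / y + z} -> slot_additive T ->
  slot_additive (slot_sum a T).
Proof.
move=> aD Tadd xs y z ys; elim: xs T Tadd => [|x xs IH] T Tadd /=.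
  rewrite !slot_sum_cons aD (Tadd [::]) addrACA -slot_sumD; congr (_ + _).
  by apply: eq_bigr => i _; apply: (Tadd [::]).
rewrite !slot_sum_cons (IH _ (slot_additive_cons x Tadd)).
by rewrite (Tadd (a x :: xs)) addrACA.
Qed.

(** The double sum consists of terms with [a] and [b] in different slots, symmetric in the two maps,
    and of terms with [b (a y)] in one slot; adding the opposite composite makes the whole
    symmetric. *)
Lemma slot_sum_comm a b T ys : slot_additive T ->
  slot_sum a (slot_sum b T) ys + slot_sum (fun y => a (b y)) T ys =
  slot_sum b (slot_sum a T) ys + slot_sum (fun y => b (a y)) T ys.
Proof.
elim: ys T => [|y ys IH] T Tadd; first by rewrite !slot_sum_nil.
(* The head slot is hit by both maps, by [c] alone, by [d] alone or by neither. *)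
have split2 c d : slot_sum c (slot_sum d T) (y :: ys) =
    T (d (c y) :: ys) + slot_sum d (fun zs => T (c y :: zs)) ys +
    (slot_sum c (fun zs => T (d y :: zs)) ys +
     slot_sum c (slot_sum d (fun zs => T (y :: zs))) ys).
  rewrite !slot_sum_cons -slot_sumD; congr (_ + _).
  by apply: eq_bigr => i _; rewrite slot_sum_cons.
have {}IH := IH _ (slot_additive_cons y Tadd).
rewrite !split2 !(slot_sum_cons _ T).
rewrite [LHS](AC ((2*2)*2) (((1*2)*(3*5))*(4*6)))/= IH.
by rewrite [RHS](AC ((2*2)*2) (((5*3)*(2*1))*(4*6))).
Qed.

(** By this recursion, prepending an argument turns a swap at m into a swap at m+1 by
    computation. *)
Fixpoint swap_at {C : Type} (m : nat) (s : seq C) : seq C :=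
  match m, s with
  | 0, x :: y :: s' => y :: x :: s'
  | m'.+1, x :: s' => x :: swap_at m' s'
  | _, _ => s
  end.

(** All slots are treated alike, so a swap only reorders the summands. *)
Lemma slot_sum_swap a T m ys :
  slot_sum a (T \o swap_at m) ys = slot_sum a T (swap_at m ys).
Proof.
elim: m T ys => [|m IH] T [|y ys] /=; rewrite ?slot_sum_nil //; last first.
  by rewrite !slot_sum_cons /= -IH.
by case: ys => [|z ys] /=; rewrite !slot_sum_cons ?slot_sum_nil //= addrCA.
Qed.

End SlotSums.

Lemma size_swap_at C m (s : seq C) : size (swap_at m s) = size s.
Proof. by elim: m s => [|m IH] [|x s] //=; [case: s | rewrite IH]. Qed.

Lemma nth_swap_at C (x0 : C) m s i : (m.+1 < size s)%N ->
  nth x0 (swap_at m s) i =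
  nth x0 s (if i == m then m.+1 else if i == m.+1 then m else i).
Proof.
elim: m s i => [|m IH] [|x s] // i lt_m.
  by case: s i lt_m => [|y s] [|[|i]].
by case: i => [|i] //=; rewrite IH // !eqSS; case: ifP => // _; case: ifP.
Qed.

Section Connections.
Context (R : realType) (n : nat) (M : manifold R n).
Context (V : lmodType (smooth_fun M)) (N : connection V).
Implicit Types X Y : vfield M.

Lemma nabla0 X : N X 0 = 0.
Proof. by apply: (addrI (N X 0)); rewrite -nablaDr !addr0. Qed.

Lemma nablaN X s : N X (- s) = - N X s.
Proof. by apply: (addrI (N X s)); rewrite -nablaDr !subrr nabla0. Qed.

Lemma nablaB X s t : N X (s - t) = N X s - N X t.
Proof. by rewrite nablaDr nablaN. Qed.

Lemma nablaBl X Y s : N (X - Y) s = N X s - N Y s.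
Proof.
by apply: (addIr (N Y s)); rewrite -nablaDl !subrK.
Qed.

End Connections.

(** * Covariant derivatives: additivity, swapped arguments, curvature *)

Section RicciIdentity.
Context (R : realType) (n : nat) (M : manifold R n).
Context (D : connection (vfield M)) (V : lmodType (smooth_fun M))
        (N : connection V).
Implicit Types (T : tensor V) (X Y : vfield M).

Lemma nabla_slot_sum X a T ys :
  N X (slot_sum a T ys) = slot_sum a (fun zs => N X (T zs)) ys.
Proof. exact: (big_morph _ (nablaDr N X) (nabla0 N X)). Qed.

Lemma covd_cons T Y ys :
  covd D N T (Y :: ys) = N Y (T ys) - slot_sum (D Y) T ys.
Proof. by []. Qed.

Lemma covdB T1 T2 : covd D N (fun xs => T1 xs - T2 xs) =
  (fun xs => covd D N T1 xs - covd D N T2 xs).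
Proof.
apply: boolp.funext => -[|Y ys]; first by rewrite subr0.
by rewrite !covd_cons slot_sumB nablaB !opprD addrACA.
Qed.

(** The new direction is prepended, which moves the swapped pair one slot to the right. *)
Lemma covd_swap T m : covd D N (T \o swap_at m) = covd D N T \o swap_at m.+1.
Proof.
by apply: boolp.funext => -[|Y ys] //; rewrite covd_cons slot_sum_swap.
Qed.

Lemma iter_covdB j T1 T2 : iter_covd D N j (fun xs => T1 xs - T2 xs) =
  (fun xs => iter_covd D N j T1 xs - iter_covd D N j T2 xs).
Proof. by elim: j => //= j ->; rewrite covdB. Qed.

Lemma iter_covd_swap j T : iter_covd D N j (T \o swap_at 0) =
  iter_covd D N j T \o swap_at j.
Proof. by elim: j => //= j ->; rewrite covd_swap. Qed.

Lemma covd_additive T : slot_additive T -> slot_additive (covd D N T).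
Proof.
(* For an empty prefix the sum stands in the direction of differentiation, otherwise in an argument
   of [T]. *)
move=> Tadd [|x xs] y z ys; rewrite ?cat0s ?cat_cons !covd_cons.
  have -> : D (y + z) = (fun w => D y w + D z w) :> (_ -> _).
    by apply: boolp.funext => w; rewrite nablaDl.
  by rewrite nablaDl slot_sum_funD // opprD addrACA.
rewrite Tadd nablaDr slot_sum_additive //; first by rewrite opprD addrACA.
exact: nablaDr.
Qed.

Lemma nablak_additive m psi : slot_additive (nablak D N m psi).
Proof.
elim: m => [|m IH]; last exact: covd_additive.
by case=> [|x xs] y z ys; rewrite /= addr0.
Qed.

Hypothesis torsion_free : forall X Y, D X Y - D Y X = lie_bracket X Y.

(** Expand both second derivatives. The mixed terms cancel, and vanishing torsion turns
    [D A B - D B A] into the bracket, both in the direction of [N] and inside the slots. *)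
Lemma ricci_identity T : slot_additive T ->
  curv D N T = (fun xs => covd D N (covd D N T) xs
                          - covd D N (covd D N T) (swap_at 0 xs)).
Proof.
move=> Tadd; apply: boolp.funext => -[|A [|B ys]]; rewrite ?subrr //.
have covd2 X Y : covd D N (covd D N T) (X :: Y :: ys) =
    N X (N Y (T ys)) - slot_sum (D Y) (fun zs => N X (T zs)) ys
    - (N (D X Y) (T ys) - slot_sum (D (D X Y)) T ys
       + (slot_sum (D X) (fun zs => N Y (T zs)) ys
          - slot_sum (D X) (slot_sum (D Y) T) ys)).
  by rewrite !covd_cons slot_sum_cons !covd_cons nablaB nabla_slot_sum
    -slot_sumB.
have curvD : slot_sum (curvature D A B) T ys =
    slot_sum (fun y => D A (D B y)) T ys - slot_sum (fun y => D B (D A y)) T ys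
    - (slot_sum (D (D A B)) T ys - slot_sum (D (D B A)) T ys).
  rewrite -!slot_sum_funB //; apply: eq_bigr => i _.
  congr (T (set_nth _ _ _ _)).
  by rewrite /curvature -torsion_free nablaBl.
rewrite /swap_at !covd2 /= -/(slot_sum (curvature D A B) T ys) curvD.
rewrite /curvature -torsion_free nablaBl.
have /(canRL (addrK _)) -> := slot_sum_comm (D A) (D B) ys Tadd.
rewrite !(opprD, opprK, addrA).
(* The bracketed pairs cancel: the two mixed terms of one [N] with one slot sum, and the double slot
   sum. *)
rewrite [RHS](ACl (1*9*3*11*8*7*4*12*(2*13)*(5*10)*(6*14)))/=.
by rewrite !addNr subrr !addr0.
Qed.

(** Differentiating the Ricci identity j times moves the swap from slot 0 to slot j. *)
Lemma iter_covd_curv j m psi xs :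
  iter_covd D N j (curv D N (nablak D N m psi)) xs =
  nablak D N (j + m.+2) psi xs - nablak D N (j + m.+2) psi (swap_at j xs).
Proof.
rewrite ricci_identity; last exact: nablak_additive.
rewrite (iter_covdB j _ (covd D N (covd D N _) \o swap_at 0)) iter_covd_swap.
by rewrite /nablak /iter_covd iterD.
Qed.

End RicciIdentity.

Lemma size_map_enum (T : Type) k (f : 'I_k -> T) :
  size [seq f j | j <- enum 'I_k] = k.
Proof. by rewrite size_map size_enum_ord. Qed.

Lemma nth_map_enum (V : nmodType) k (f : 'I_k -> V) (i : 'I_k) :
  nth 0 [seq f j | j <- enum 'I_k] i = f i.
Proof. by rewrite (nth_map i) ?size_enum_ord // nth_ord_enum. Qed.

(** * Permutations with a given largest moved index *)

Section SymFirst.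
Context {k : nat}.
Implicit Types (s : 'S_k) (m i : 'I_k).

Lemma Sym_firstP l s :
  reflect (forall i : 'I_k, (l <= i)%N -> s i = i) (s \in Sym_first k l).
Proof.
rewrite inE; apply: (iffP forallP) => fix_s i; first by
  move=> le_li; apply/eqP; exact: (implyP (fix_s i)).
by apply/implyP => le_li; rewrite fix_s.
Qed.

Lemma Sym_firstT : Sym_first k k = [set: 'S_k].
Proof.
apply/setP => s; rewrite in_setT; apply/Sym_firstP => i.
by rewrite leqNgt ltn_ord.
Qed.

Lemma Sym_first0 : Sym_first k 0 = [set (1 : 'S_k)%g].
Proof.
apply/setP => s; rewrite in_set1; apply/Sym_firstP/eqP => [fix_s|-> i _].
  by apply/permP => i; rewrite fix_s ?perm1.
by rewrite perm1.
Qed.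

Lemma Sym_first_sub l l' : (l <= l')%N -> Sym_first k l \subset Sym_first k l'.
Proof.
move=> le_ll'; apply/subsetP => s /Sym_firstP fix_s; apply/Sym_firstP => i.
by move/(leq_trans le_ll'); apply: fix_s.
Qed.

(** If [i < l] had [s i >= l], then [s] would fix [s i], and injectivity would give [s i = i]. *)
Lemma Sym_first_ltn l s i : s \in Sym_first k l -> (s i < l)%N = (i < l)%N.
Proof.
move=> /Sym_firstP fix_s; have [le_li|lt_il] := leqP l i.
  by rewrite fix_s // ltnNge le_li.
rewrite ltnNge; apply/negP => le_lsi.
have /perm_inj si : s (s i) = s i by exact: fix_s.
by rewrite si leqNgt lt_il in le_lsi.
Qed.

Lemma Sym_firstS m s : s \in Sym_first k m.+1 ->
  (s \in Sym_first k m) = (s m == m).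
Proof.
move=> /Sym_firstP fix_s; apply/Sym_firstP/eqP => [->//|sm i].
by rewrite leq_eqVlt => /orP[/eqP/val_inj<- //|]; apply: fix_s.
Qed.

Lemma Sym_first_permV_le m s : s \in Sym_first k m.+1 ->
  ((s^-1%g : 'S_k) m <= m)%N.
Proof.
by move=> sS; rewrite -ltnS -(Sym_first_ltn _ sS) permKV.
Qed.

(** This makes the layers between consecutive subgroups the level sets of the largest moved
    index. *)
Lemma top_moved_Sym_first m s :
  s \in Sym_first k m.+1 :\: Sym_first k m -> top_moved s = Some m.
Proof.
rewrite in_setD => /andP[sNm sS]; rewrite (Sym_firstS sS) in sNm.
move/Sym_firstP in sS.
rewrite /top_moved; case: pickP => [i /andP[si /forallP fix_s]|/(_ m)].
  congr Some; apply/val_inj/eqP; rewrite eqn_leq; apply/andP; split.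
    by rewrite leqNgt; apply/negP => /sS /eqP; rewrite (negPf si).
  rewrite leqNgt; apply/negP => /(implyP (fix_s m)).
  by rewrite (negPf sNm).
rewrite sNm /= => /forallP[] j; apply/implyP => lt_mj.
by rewrite sS.
Qed.

End SymFirst.

(** * Summation by parts over the position of the largest moved index *)

Lemma telescope_mulrn (V : zmodType) (A : nat -> V) m :
  \sum_(j < m) (A j - A j.+1) *+ j.+1 = \sum_(j < m.+1) A j - A m *+ m.+1.
Proof.
elim: m => [|m IH]; first by rewrite big_ord0 big_ord1 subrr.
rewrite big_ord_recr /= IH [in RHS]big_ord_recr /=.
by rewrite mulrnBl addrA subrK [A m.+1 *+ m.+2]mulrS opprD addrA addrK.
Qed.

(* ordS is the cyclic successor; it does not wrap around here because
   s^-1 m < m for s outside S_m. *)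
Lemma sum_adjacent_swaps (V : zmodType) k (F : 'S_k -> V) (m : 'I_k) :
  \sum_(s in Sym_first k m.+1 :\: Sym_first k m)
     (let j := (s^-1%g : 'S_k) m in (F s - F (tperm j (ordS j) * s)%g) *+ j.+1)
  = \sum_(s in Sym_first k m.+1) F s - (\sum_(s in Sym_first k m) F s) *+ m.+1.
Proof.
pose A j := \sum_(s in Sym_first k m.+1 | (s^-1%g : 'S_k) m == j :> nat) F s.
have sum_by_pos (P : pred 'S_k) (G : 'S_k -> V) b :
    (forall s, P s -> ((s^-1%g : 'S_k) m < b)%N) ->
    \sum_(s | P s) G s =
    \sum_(j < b) \sum_(s | P s && ((s^-1%g : 'S_k) m == j :> nat)) G s.
  (* The bound 0 is separate because [inord] needs a nonempty ordinal type. *)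
  case: b => [|b] Pb.
    by rewrite big_ord0 big_pred0 // => s; apply/negP => /Pb.
  pose pos s : 'I_b.+1 := inord ((s^-1%g : 'S_k) m).
  rewrite (partition_big pos xpredT) //.
  apply: eq_bigr => j _; apply: eq_bigl => s.
  by case Ps: (P s) => //=; rewrite -val_eqE /= inordK // Pb.
have -> : \sum_(s in Sym_first k m.+1) F s = \sum_(j < m.+1) A j.
  by apply: sum_by_pos => s /Sym_first_permV_le.
have -> : \sum_(s in Sym_first k m) F s = A m.
  apply: eq_bigl => s; rewrite val_eqE.
  have [sS|sNS] := boolP (s \in Sym_first k m.+1).
    by rewrite (Sym_firstS sS) (can2_eq (permKV s) (permK s)) eq_sym.
  by apply: contraNF sNS; apply/subsetP; apply: Sym_first_sub.
rewrite -telescope_mulrn (sum_by_pos _ _ m); last first.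
  move=> s; rewrite in_setD => /andP[sNm sS].
  rewrite ltn_neqAle Sym_first_permV_le // andbT val_eqE.
  by rewrite (can2_eq (permKV s) (permK s)) eq_sym -(Sym_firstS sS).
apply: eq_bigr => j _.
have lt_jk : (j < k)%N by exact: ltn_trans (ltn_ord j) (ltn_ord m).
have lt_j1k : (j.+1 < k)%N by exact: leq_ltn_trans (ltn_ord j) (ltn_ord m).
pose J := Ordinal lt_jk; have J1 : ordS J = Ordinal lt_j1k.
  by apply: val_inj; rewrite /= modn_small.
(* As [j < m], a permutation taking the value m at j does not fix m, so it lies outside S_m. *)
have posE s : (s \in Sym_first k m.+1 :\: Sym_first k m) &&
    ((s^-1%g : 'S_k) m == j :> nat) =
    (s \in Sym_first k m.+1) && ((s^-1%g : 'S_k) m == j :> nat).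
  rewrite in_setD; case sS: (s \in Sym_first k m.+1); rewrite ?andbF //= andbT.
  rewrite (Sym_firstS sS) andbC; case: eqP => //= sj.
  apply/negP => /eqP /(canRL (permK s)) /(congr1 val) /= sm.
  by have := ltn_ord j; rewrite -sj -sm ltnn.
rewrite (eq_bigl _ _ posE).
(* Products apply the left factor first, so multiplying by the transposition on the left exchanges
   the positions j and j+1 of the value m. *)
have -> : A j.+1 = \sum_(s in Sym_first k m.+1 | (s^-1%g : 'S_k) m == j :> nat)
    F (tperm J (ordS J) * s)%g.
  rewrite /A (reindex_inj (mulgI (tperm J (ordS J)))) /=.
  apply: eq_bigl => s; rewrite invMg permM tpermV; congr (_ && _).
    have tS : tperm J (ordS J) \in Sym_first k m.+1.
      apply/Sym_firstP => i lt_mi; rewrite tpermD //; apply/negP => /eqP.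
        move=> /(congr1 val) /= ji; move: (ltn_ord j).
        by rewrite ji ltnNge ltnW.
      rewrite J1 => /(congr1 val) /= ji; move: (ltn_ord j).
      by rewrite ji leqNgt lt_mi.
    have MS t s' : t \in Sym_first k m.+1 -> s' \in Sym_first k m.+1 ->
        (t * s')%g \in Sym_first k m.+1.
      move=> /Sym_firstP ft /Sym_firstP fs; apply/Sym_firstP => i lt_mi.
      by rewrite permM ft ?fs.
    apply/idP/idP => [/(MS _ _ tS)|]; last exact: MS.
    by rewrite mulgA tperm2 mul1g.
  have eqJ i : (i == j :> nat) = (i == J) by [].
  have eqJ1 (i : 'I_k) : (i == j.+1 :> nat) = (i == ordS J) by rewrite J1.
  rewrite eqJ eqJ1 -[X in _ == X](tpermL J (ordS J)).
  by rewrite (inj_eq perm_inj).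
rewrite -sumrB -sumrMnl; apply: eq_bigr => s /andP[_ /eqP sj] /=.
by have -> : (s^-1%g : 'S_k) m = J by apply: val_inj.
Qed.

(** * The inclusion of S_l into S_k *)

Section ExtendPerm.
Context {l k : nat} (le_lk : (l <= k)%N).
Implicit Types s : 'S_l.

Definition extend_fun s (i : 'I_k) : 'I_k :=
  if insub (val i) is Some j then widen_ord le_lk (s j) else i.

Lemma extend_fun_widen s j :
  extend_fun s (widen_ord le_lk j) = widen_ord le_lk (s j).
Proof. by rewrite /extend_fun /= valK. Qed.

Lemma extend_fun_fix s (i : 'I_k) : (l <= i)%N -> extend_fun s i = i.
Proof. by move=> le_li; rewrite /extend_fun insubN // -leqNgt. Qed.

Lemma extend_fun_inj s : injective (extend_fun s).
Proof.
apply: (can_inj (g := extend_fun s^-1)) => i.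
have [le_li|lt_il] := leqP l i; first by rewrite !extend_fun_fix.
have -> : i = widen_ord le_lk (Ordinal lt_il) by apply: val_inj.
by rewrite !extend_fun_widen permK.
Qed.

Definition extend_perm s : 'S_k := perm (@extend_fun_inj s).

(** A permutation fixing all indices from l on preserves those below l, hence is the extension of
    its restriction. *)
Lemma Sym_first_extend : Sym_first k l = [set extend_perm s | s : 'S_l].
Proof.
apply/setP => s; apply/idP/imsetP => [sS|[t _ ->]]; last first.
  by apply/Sym_firstP => i le_li; rewrite permE extend_fun_fix.
have s_lt (j : 'I_l) : (s (widen_ord le_lk j) < l)%N.
  by rewrite (Sym_first_ltn _ sS) /= ltn_ord.
have f_inj : injective (fun j => Ordinal (s_lt j)).
  move=> i j /(congr1 val) /= /val_inj /perm_inj /(congr1 val) /= ij.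
  exact: val_inj.
exists (perm f_inj) => //; apply/permP => i; rewrite permE.
have [le_li|lt_il] := leqP l i.
  by rewrite extend_fun_fix //; apply: (Sym_firstP _ _ sS).
have -> : i = widen_ord le_lk (Ordinal lt_il) by apply: val_inj.
by rewrite extend_fun_widen permE; apply: val_inj.
Qed.

Lemma sum_Sym_first (V : nmodType) (F : 'S_k -> V) :
  \sum_(s in Sym_first k l) F s = \sum_(s : 'S_l) F (extend_perm s).
Proof.
rewrite Sym_first_extend big_imset //= => s t _ _ /permP eq_st.
apply/permP => j; apply: val_inj.
have /(congr1 val) := eq_st (widen_ord le_lk j).
by rewrite !permE !extend_fun_widen.
Qed.

Lemma map_extend_perm (V : nmodType) (X : 'I_k -> V) s :
  [seq X (extend_perm s i) | i <- enum 'I_k] =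
  [seq X (widen_ord le_lk (s i)) | i <- enum 'I_l]
  ++ drop l [seq X i | i <- enum 'I_k].
Proof.
apply: (@eq_from_nth _ 0) => [|i].
  by rewrite size_cat size_drop !size_map_enum subnKC.
rewrite size_map_enum => lt_ik.
rewrite (nth_map_enum (X \o extend_perm s) (Ordinal lt_ik)) /=.
rewrite nth_cat size_map_enum nth_drop permE.
case: ltnP => [lt_il|le_li].
  rewrite (nth_map_enum (fun j => X (widen_ord le_lk (s j))) (Ordinal lt_il)).
  by rewrite -extend_fun_widen; congr (X (extend_fun s _)); apply: val_inj.
by rewrite subnKC // (nth_map_enum X (Ordinal lt_ik)) extend_fun_fix.
Qed.

End ExtendPerm.

(** * Factorial coefficients as constant functions *)

Section Scalars.
Context {R : realType} {n : nat} {M : manifold R n}.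
Context {V : lmodType (smooth_fun M)}.
Implicit Types (a : R) (v : V) (m : nat).

Lemma sf_cst_scale_natr a v m :
  sf_cst M (m%:R * a) *: v = sf_cst M a *: (v *+ m).
Proof.
rewrite mulr_natl; elim: m => [|m IH].
  by rewrite mulr0n mulr0n scaler0 [sf_cst M 0](_ : _ = 0) ?scale0r.
rewrite !mulrS scalerDr -IH -scalerDl; congr (_ *: _).
exact: smooth_fun_inj.
Qed.

(** Gives the boundary term of the summation by parts the coefficient of the average over S_m. *)
Lemma sf_cst_invfactS m v :
  sf_cst M m.+1`!%:R^-1 *: (v *+ m.+1) = sf_cst M m`!%:R^-1 *: v.
Proof.
rewrite -sf_cst_scale_natr factS natrM invfM mulrA divff ?mul1r //.
by rewrite Num.Theory.pnatr_eq0.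
Qed.

End Scalars.

(** * Expansion of the symmetrized derivative *)

Section JetExpansion.
Context (R : realType) (n : nat) (M : manifold R n).
Context (D : connection (vfield M)) (V : lmodType (smooth_fun M))
        (N : connection V).
Hypothesis torsion_free :
  forall X Y : vfield M, D X Y - D Y X = lie_bracket X Y.
Context (psi : V) (k : nat) (X : 'I_k -> vfield M).

Definition permuted_nablak (s : 'S_k) : V :=
  nablak D N k psi [seq X (s i) | i <- enum 'I_k].

Lemma curv_termE (m : 'I_k) (s : 'S_k) :
  s \in Sym_first k m.+1 :\: Sym_first k m ->
  let j := (s^-1%g : 'S_k) m in
  curv_term D N X psi s = sf_cst M m.+1`!%:R^-1 *:
    ((permuted_nablak s - permuted_nablak (tperm j (ordS j) * s)%g) *+ j.+1).
Proof.
move=> sS j; rewrite /curv_term (top_moved_Sym_first sS) -/j -/(j.+1%:R / _).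
rewrite sf_cst_scale_natr.
have lt_jm : (j < m)%N.
  move: sS; rewrite in_setD => /andP[sNm sS].
  rewrite ltn_neqAle Sym_first_permV_le // andbT val_eqE.
  by rewrite (can2_eq (permKV s) (permK s)) eq_sym -(Sym_firstS sS).
have lt_j1k : (j.+1 < k)%N by exact: leq_ltn_trans lt_jm (ltn_ord m).
have ordSj : ordS j = Ordinal lt_j1k.
  by apply: val_inj; rewrite /= modn_small.
set Xs := [seq X (s i) | i <- enum 'I_k].
have sizeXs : size Xs = k by rewrite size_map_enum.
have dropE i : (i < k)%N -> drop i Xs = Xs`_i :: drop i.+1 Xs.
  by move=> lt_ik; rewrite -drop_nth ?sizeXs.
(* Since [s j = m], the vector field [X m] is entry j of [Xs]. *)
have -> : take j Xs ++ [:: X m, Xs`_j.+1 & drop j.+2 Xs] = Xs.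
  rewrite -[RHS](cat_take_drop j); congr (_ ++ _).
  rewrite (dropE j) // (dropE j.+1) //.
  by rewrite [Xs`_j](nth_map_enum (X \o s) j) /= permKV.
rewrite iter_covd_curv // -!addSnnS subnKC //.
congr (_ *: ((_ - nablak _ _ _ _ _) *+ _)).
apply: (@eq_from_nth _ 0) => [|i].
  by rewrite size_swap_at sizeXs size_map_enum.
rewrite size_swap_at sizeXs => lt_ik; rewrite nth_swap_at ?sizeXs //.
have nthXs i' : nth 0 Xs (i' : 'I_k) = X (s i').
  exact: (nth_map_enum (X \o s)).
rewrite (nth_map_enum (X \o (tperm j (ordS j) * s)%g) (Ordinal lt_ik)) /=.
rewrite permM -nthXs ordSj; congr nth.
(* Swapping the entries j and j+1 of the list agrees with precomposing [s] with the
   transposition. *)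
rewrite -[i]/(val (Ordinal lt_ik)); case: tpermP => [->|->|] /=.
- by rewrite eqxx.
- by rewrite eqxx gtn_eqF.
- by move=> /eqP/negPf + /eqP/negPf; rewrite -!val_eqE /= => -> ->.
Qed.

Lemma sum_curv_term (l m : nat) : (l <= m <= k)%N ->
  \sum_(s in Sym_first k m :\: Sym_first k l) curv_term D N X psi s =
  sf_cst M m`!%:R^-1 *: (\sum_(s in Sym_first k m) permuted_nablak s) -
  sf_cst M l`!%:R^-1 *: (\sum_(s in Sym_first k l) permuted_nablak s).
Proof.
elim: m => [|m IH] /andP[].
  by rewrite leqn0 => /eqP-> _; rewrite setDv big_set0 subrr.
rewrite leq_eqVlt ltnS => /predU1P[-> _|le_lm lt_mk].
  by rewrite setDv big_set0 subrr.
(* Split off the layer of permutations whose largest moved index is m. *)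
rewrite (big_setID (Sym_first k m)) /= setIDAC setDDl.
rewrite (setIidPr (Sym_first_sub (leqnSn m))) (setUidPr (Sym_first_sub le_lm)).
rewrite IH ?le_lm 1?ltnW // addrC addrA; congr (_ - _).
have step s : s \in Sym_first k m.+1 :\: Sym_first k m ->
    curv_term D N X psi s = _ := @curv_termE (Ordinal lt_mk) s.
rewrite (eq_bigr _ step) -scaler_sumr.
rewrite (sum_adjacent_swaps permuted_nablak (Ordinal lt_mk)) /=.
by rewrite scalerBr sf_cst_invfactS subrK.
Qed.

(** The l outer derivatives and the k - l inner ones compose to [nablak] of order k, symmetrized
    over the copy of S_l in S_k. *)
Lemma jet_nablakE l (le_lk : (l <= k)%N) :
  jet D N (nablak D N (k - l) psi) (fun i => X (widen_ord le_lk i))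
    (drop l [seq X i | i <- enum 'I_k]) =
  sf_cst M l`!%:R^-1 *: (\sum_(s in Sym_first k l) permuted_nablak s).
Proof.
rewrite (sum_Sym_first le_lk) /jet; congr (_ *: _); apply: eq_bigr => s _.
by rewrite /permuted_nablak map_extend_perm /nablak /iter_covd -iterD subnKC.
Qed.

Lemma jetE : jet D N (tensor_of_section psi) X [::] =
  sf_cst M k`!%:R^-1 *: (\sum_(s in Sym_first k k) permuted_nablak s).
Proof.
rewrite Sym_firstT /jet; congr (_ *: _).
by apply: eq_big => [s|s _]; rewrite ?in_setT ?cats0.
Qed.

Lemma sum_curv_term_setC l : (l <= k)%N ->
  \sum_(s in ~: Sym_first k l) curv_term D N X psi s =
  jet D N (tensor_of_section psi) X [::] -
  sf_cst M l`!%:R^-1 *: (\sum_(s in Sym_first k l) permuted_nablak s).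
Proof.
by move=> le_lk; rewrite jetE -sum_curv_term ?le_lk ?leqnn // Sym_firstT setTD.
Qed.

End JetExpansion.

Unset Implicit Arguments.
Set Strict Implicit.
Set Printing Implicit Defensive.

(* The tangent vectors x i enter through arbitrary vector fields X i extending
   them; both sides are then values of tensors at p. *)
Theorem proposition2 (R : realType) (n : nat) (M : manifold R n) (g : metric M)
    (D : connection (vfield M)) (D_lc : is_levi_civita g D)
    (r : nat) (E : vbundle M r) (N : connection (section E)) (psi : section E)
    (l k : nat) (le_lk : (l <= k)%N)
    (p : M) (x : 'I_k -> tangent p)
    (X : 'I_k -> vfield M) (X_at_p : forall i, vfield_at p (X i) = x i) :
  (jet D N (tensor_of_section psi) X [::]
   - jet D N (nablak D N (k - l) psi) (fun i : 'I_l => X (widen_ord le_lk i))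
         (drop l [seq X i | i <- enum 'I_k])) p
  = (\sum_(s in ~: Sym_first k l) curv_term D N X psi s) p
  /\
  (jet D N (tensor_of_section psi) X [::]
   - nablak D N k psi [seq X i | i <- enum 'I_k]) p
  = (\sum_(s : 'S_k | s != 1%g) curv_term D N X psi s) p.
Proof.
(* Both equalities already hold between sections, before evaluation at [p]. *)
have [torsion_free _] := D_lc; split; congr (section_val _ p).
  by rewrite jet_nablakE sum_curv_term_setC.
(* The second formula comes from the index 0: S_0 is trivial and 0! = 1. *)
under eq_bigl => s do rewrite -in_set1 -Sym_first0 -in_setC.
rewrite sum_curv_term_setC // Sym_first0 big_set1 fact0 invr1 scale1r.
congr (_ - nablak _ _ _ _ _); by apply: eq_map => i; rewrite perm1.
Qed.
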